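(* $\delta_4\le 0.9415$.
   Context: All graphs are finite and simple. For a graph $G$, $P_{3}(G)$ denotes the largest number of edges in a $3$-partite subgraph of $G$, and $K_4f(G)$ denotes the largest number of edges in a $K_4$-free subgraph of $G$. The number $\delta_4$ is the least number (understood as the infimum of all real numbers $c$) such that, for all sufficiently large $n$, every graph $G$ on $n$ vertices with minimum degree $\delta(G)\ge c\,n$ satisfies $P_{3}(G)=K_4f(G)$. *)

(* Defs.v *)
From mathcomp Require Import all_boot all_order all_algebra.
Set Implicit Arguments.
Unset Strict Implicit.
Unset Printing Implicit Defensive.

(* A finite simple graph on the vertex type V is given by its edge set. *)
Definition simple_graph (V : finType) (G : {set {set V}}) : bool :=
  [forall e in G, #|e| == 2].

Definition adj (V : finType) (G : {set {set V}}) (x y : V) : bool :=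
  [set x; y] \in G.

Definition degree (V : finType) (G : {set {set V}}) (x : V) : nat :=
  #|[set y | adj G x y]|.

(* Degrees never exceed #|V|, so the default value is irrelevant as soon as V
   is nonempty. *)
Definition min_degree (V : finType) (G : {set {set V}}) : nat :=
  \big[minn/#|V|]_(x : V) degree G x.

(* Parts are allowed to be empty. *)
Definition partite (k : nat) (V : finType) (G : {set {set V}}) : bool :=
  [exists f : {ffun V -> 'I_k}, forall x, forall y, adj G x y ==> (f x != f y)].

Definition clique (V : finType) (G : {set {set V}}) (K : {set V}) : bool :=
  [forall x in K, forall y in K, (x != y) ==> adj G x y].

Definition clique_free (k : nat) (V : finType) (G : {set {set V}}) : bool :=
  ~~ [exists K : {set V}, (#|K| == k) && clique G K].

(* Subgraphs are taken spanning, i.e. as subsets of the edge set: adding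
   isolated vertices changes neither the number of edges nor the property of
   being 3-partite or K_4-free. *)
Definition P3 (V : finType) (G : {set {set V}}) : nat :=
  \max_(H : {set {set V}} | (H \subset G) && partite 3 H) #|H|.

Definition K4f (V : finType) (G : {set {set V}}) : nat :=
  \max_(H : {set {set V}} | (H \subset G) && clique_free 4 H) #|H|.

From mathcomp Require Import all_classical all_reals all_analysis.
Import Order.TTheory GRing.Theory Num.Theory.
Local Open Scope classical_set_scope.
Local Open Scope ring_scope.

Definition P3_eq_K4f_threshold (R : realType) (c : R) : Prop :=
  \forall n \near \oo, forall (V : finType) (G : {set {set V}}),
    #|V| = n -> simple_graph G -> c * n%:R <= (min_degree G)%:R ->
    P3 G = K4f G.

(* The infimum is taken in the extended reals so that no default value of a
   real-valued infimum can interfere. *)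
Definition delta4 (R : realType) : \bar R :=
  ereal_inf [set c%:E | c in [set c : R | P3_eq_K4f_threshold c]].

(* Main.v *)
Require Import Defs.
From mathcomp Require Import all_boot all_order all_algebra.
From mathcomp Require Import zify lra.

(** Let [G] have [n] vertices, each adjacent to at least [c n] others, where
    [c = 0.9415], and let [H] be a [K_4]-free subgraph of [G].  The point is to
    find a 3-partite subgraph of [G] with at least [|H|] edges.

    Two facts are used throughout.  A [p]-colouring of a set [W] extends vertex
    by vertex, greedily, so that a proportion at least [1 - 1/p] of the new
    edges of [G] is cut ([extend_colouring]); in particular one may assume
    [|H| > 2/3 |G|].  And deleting from [H], one at a time, vertices of degree
    at most [3/5] of the current order leads to a set [W] on which [H] has
    minimum degree above [3|W|/5] ([dense_core]).  Each deletion loses at most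
    [3/5] of the current order in [H], less on average than what the greedy
    extension regains in [G], whose degrees are close to [n].  So it suffices to
    colour [W] and cut there as many edges of [G] as [H] has.

    The degree [3/5] is not enough to make [H] 3-partite on [W] (a blow-up of a
    5-wheel shows it), but it forces a weaker structure: if [I] is a maximum
    independent set of [H] in [W], then [S := W \ I] spans no triangle
    ([dense_K4free_split]).  Giving [I] a colour of its own cuts every edge of
    [G] between [I] and [S], so only the triangle-free graph that [H] induces
    on [S] remains to be compared with the bipartite subgraphs of [G] on [S].

    That comparison is the same argument one dimension lower
    ([trifree_bicolour]): with [2/5] in place of [3/5], the graph left after the
    deletions is bipartite ([dense_trifree_bipartite]).  It needs [S] to be a
    fair proportion of [V].  This follows from [|H| > 2/3 |G|]: the number of
    edges of [H] on [W] is at most [|I||S| + |S|^2/4], while the deletions cost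
    at most [3/10 (n^2 - |W|^2)] edges, and together these bounds give
    [|S| >= 0.4035 n]. *)

Set Implicit Arguments.
Unset Strict Implicit.
Unset Printing Implicit Defensive.

(** * Counting ordered adjacent pairs *)

Section Counting.
Variable V : finType.
Implicit Types (r g h : rel V) (A B C W I J S : {set V}).

Definition deg_in r A (x : V) : nat := \sum_(y in A) r x y.

(** Edges are counted as ordered pairs, so [arcs r A A] is twice the number of
    edges inside [A]; this spares every division by two. *)
Definition arcs r A B : nat := \sum_(x in A) deg_in r B x.

Definition cut_rel p r (f : V -> 'I_p) : rel V :=
  fun x y => r x y && (f x != f y).

Definition indep r A := {in A &, forall x y, ~~ r x y}.

Definition trifree r A :=
  {in A & &, forall x y z, ~~ [&& r x y, r x z & r y z]}.

Definition K4free r := forall x y z w,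
  ~~ [&& r x y, r x z, r x w, r y z, r y w & r z w].

Lemma card_sum1 A : #|A| = \sum_(z in A) 1.
Proof. by rewrite sum1_card. Qed.

Lemma card_sum_mem A B : A \subset B -> #|A| = \sum_(z in B) (z \in A).
Proof.
move=> sAB; rewrite -sum1_card big_mkcond [RHS]big_mkcond /=.
apply: eq_bigr => z _; case: (boolP (z \in A)) => [/(subsetP sAB) -> //|_].
by case: ifP.
Qed.

Lemma disjoint_setD A B : [disjoint A & B :\: A].
Proof. by rewrite -setI_eq0; apply/eqP/setP=> x; rewrite !inE; case: (x \in A). Qed.

Lemma setU_setD A B : A \subset B -> A :|: B :\: A = B.
Proof. by move=> sAB; rewrite -{2}(setID B A) (setIidPr sAB). Qed.

Lemma card_setD_add A B : A \subset B -> #|B :\: A| + #|A| = #|B|.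
Proof. by move=> sAB; rewrite -(cardsID A B) (setIidPr sAB) addnC. Qed.

Lemma deg_inU r x A B : [disjoint A & B] ->
  deg_in r (A :|: B) x = deg_in r A x + deg_in r B x.
Proof.
by move=> dAB; rewrite /deg_in -bigU //=; apply: eq_bigl => y; rewrite !inE.
Qed.

Lemma deg_in_card r A x : deg_in r A x = #|[set y in A | r x y]|.
Proof.
rewrite -sum1_card /deg_in; under [RHS]eq_bigl do rewrite inE.
by rewrite big_mkcondr /=; apply: eq_bigr => y _; case: (r x y).
Qed.

Lemma deg_in_le r A x : deg_in r A x <= #|A|.
Proof.
rewrite deg_in_card subset_leq_card //.
by apply/subsetP=> y; rewrite inE => /andP[].
Qed.

Lemma arcs0 r : arcs r set0 set0 = 0.
Proof. by rewrite /arcs big_set0. Qed.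

Lemma arcs_set1 r v B : arcs r [set v] B = deg_in r B v.
Proof. by rewrite /arcs big_set1. Qed.

Lemma arcsUl r A B C : [disjoint A & B] ->
  arcs r (A :|: B) C = arcs r A C + arcs r B C.
Proof.
by move=> dAB; rewrite /arcs -bigU //=; apply: eq_bigl => x; rewrite !inE.
Qed.

Lemma arcsUr r A B C : [disjoint A & B] ->
  arcs r C (A :|: B) = arcs r C A + arcs r C B.
Proof.
by move=> dAB; rewrite /arcs -big_split /=; apply: eq_bigr => x _; rewrite deg_inU.
Qed.

Lemma arcsC r A B : symmetric r -> arcs r A B = arcs r B A.
Proof.
move=> sr; rewrite /arcs /deg_in exchange_big /=.
by apply: eq_bigr => x _; apply: eq_bigr => y _; rewrite sr.
Qed.

Lemma arcsU r A B : symmetric r -> [disjoint A & B] ->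
  arcs r (A :|: B) (A :|: B) = arcs r A A + 2 * arcs r A B + arcs r B B.
Proof.
move=> sr dAB; rewrite arcsUl // !arcsUr // (arcsC B A) //; clear; lia.
Qed.

Lemma arcs_indep r A : indep r A -> arcs r A A = 0.
Proof.
move=> iA; rewrite /arcs big1 // => x xA; rewrite /deg_in big1 // => y yA.
by rewrite (negPf (iA _ _ xA yA)).
Qed.

Lemma arcs_mono r r' A B :
  (forall x y, x \in A -> y \in B -> r x y -> r' x y) -> arcs r A B <= arcs r' A B.
Proof.
move=> rr'; apply: leq_sum => x xA; apply: leq_sum => y yB.
by case: (boolP (r x y)) => [/(rr' _ _ xA yB) -> |].
Qed.

Lemma arcs_le r A B k : {in A, forall x, deg_in r B x <= k} -> arcs r A B <= #|A| * k.
Proof. by move=> H; rewrite -sum_nat_const; apply: leq_sum. Qed.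

Lemma arcs_ge r A B k : {in A, forall x, k <= deg_in r B x} -> #|A| * k <= arcs r A B.
Proof. by move=> H; rewrite -sum_nat_const; apply: leq_sum. Qed.

(** The number of edges that meet [A :\: W] is at least the sum of the degrees
    over [A :\: W] minus the edges counted twice, those inside [A :\: W]. *)
Lemma arcs_outside_ge r W A d : symmetric r -> W \subset A ->
  {in A, forall x, d <= deg_in r A x} ->
  2 * #|A :\: W| * d + arcs r W W <= arcs r A A + #|A :\: W| ^ 2.
Proof.
move=> sr sWA dA; have eA := setU_setD sWA; have dWR := disjoint_setD W A.
set R := A :\: W in eA dWR *.
have : #|R| * d <= arcs r R A by apply: arcs_ge => x /setDP[xA _]; apply: dA.
have : arcs r R R <= #|R| * #|R| by apply: arcs_le => x _; apply: deg_in_le.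
by rewrite -eA arcsU // arcsUr // (arcsC R W) // -mulnn; clear; lia.
Qed.

Lemma common_neighbour r W x y : #|W| < deg_in r W x + deg_in r W y ->
  exists2 z, z \in W & r x z && r y z.
Proof.
move=> lt; apply/exists_inP; apply: contraLR lt => /exists_inPn no.
rewrite -leqNgt -sum1_card -big_split /=; apply: leq_sum => z /no.
by case: (r x z); case: (r y z).
Qed.

(** * Greedy colouring and dense cores *)

Lemma best_colour p r (f : V -> 'I_p.+1) A v : exists c : 'I_p.+1,
  p * deg_in r A v <= p.+1 * deg_in (fun x y => r x y && (c != f y)) A v.
Proof.
(* Averaged over all colours of [v], each neighbour is separated from [v] by
   exactly [p] of the [p.+1] choices. *)
set F := fun c : 'I_p.+1 => deg_in (fun x y => r x y && (c != f y)) A v.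
have sF : \sum_c F c = p * deg_in r A v.
  rewrite /F /deg_in exchange_big /= big_distrr /=; apply: eq_bigr => y _.
  rewrite (bigD1 (f y)) //= eqxx andbF add0n.
  under eq_bigr => c nc do rewrite nc andbT.
  by rewrite sum_nat_const cardC1 card_ord.
case: (@arg_maxnP _ ord0 predT F isT) => c _ cmax; exists c.
rewrite -sF -[X in X * _]card_ord -sum_nat_const.
by apply: leq_sum => d _; apply: cmax.
Qed.

(** The case [W = set0] is the classical bound: a [p.+1]-partite subgraph can
    keep a proportion [p / p.+1] of the edges. *)
Lemma extend_colouring p r (f : V -> 'I_p.+1) W A : symmetric r -> irreflexive r ->
  W \subset A -> exists f' : V -> 'I_p.+1,
   p.+1 * arcs (cut_rel r f) W W + p * arcs r A A
   <= p.+1 * arcs (cut_rel r f') A A + p * arcs r W W.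
Proof.
move=> sr ir; move: {2}#|A :\: W| (erefl #|A :\: W|) => k.
elim: k A => [|k IH] A cA sWA.
  have -> : A = W.
    by apply/eqP; rewrite eqEsubset sWA -setD_eq0 -cards_eq0 cA.
  by exists f.
have [v vAW] : exists v, v \in A :\: W by apply/card_gt0P; rewrite cA.
have /setDP[vA vW] := vAW.
set A' := A :\ v.
have sWA' : W \subset A'.
  apply/subsetP=> x xW; rewrite !inE (subsetP sWA) // andbT.
  by apply: contraNneq vW => <-.
have [|f' Hf'] := IH A' _ sWA'.
  have -> : A' :\: W = (A :\: W) :\ v by apply/setP=> x; rewrite !inE andbCA.
  by move: cA; rewrite (cardsD1 v (A :\: W)) vAW => -[].
have dA : [disjoint [set v] & A'] by rewrite disjoints1 !inE eqxx.
have eA : A = [set v] :|: A' by rewrite /A' setD1K.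
have [c Hc] := best_colour r f' A' v.
pose f2 x := if x == v then c else f' x.
exists f2.
have sc q (ff : V -> 'I_q) : symmetric (cut_rel r ff).
  by move=> x y; rewrite /cut_rel sr eq_sym.
have vv r' : irreflexive r' -> arcs r' [set v] [set v] = 0.
  by move=> ir'; apply: arcs_indep => x y /set1P -> /set1P ->; rewrite ir'.
have icr : irreflexive (cut_rel r f2) by move=> x; rewrite /cut_rel ir.
rewrite eA !arcsU // !vv // !arcs_set1.
have -> : arcs (cut_rel r f2) A' A' = arcs (cut_rel r f') A' A'.
  apply: eq_bigr => x; rewrite !inE => /andP[xv _]; apply: eq_bigr => y.
  by rewrite !inE => /andP[yv _]; rewrite /cut_rel /f2 (negPf xv) (negPf yv).
have -> : deg_in (cut_rel r f2) A' v
        = deg_in (fun x y => r x y && (c != f' y)) A' v.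
  apply: eq_bigr => y; rewrite !inE => /andP[yv _].
  by rewrite /cut_rel /f2 eqxx (negPf yv).
by move: Hf' Hc; rewrite !add0n; clear; lia.
Qed.

(** Deleting vertices of low degree until none is left amounts to maximising
    [5 arcs r W W - t |W|^2 - (t+1)|W|]: at a maximum, no vertex can be deleted
    with profit, which is the degree condition, and comparing with [W = A]
    bounds what the deletions have cost.  The linear term [(t+1)|W|] makes the
    degree condition strict. *)
Lemma dense_core t r A : symmetric r -> irreflexive r ->
  exists2 W : {set V}, W \subset A &
   {in W, forall x, t * #|W| < 5 * deg_in r W x} /\
   5 * arcs r A A + t * #|W| ^ 2 + t.+1 * #|W|
     <= 5 * arcs r W W + t * #|A| ^ 2 + t.+1 * #|A|.
Proof.
move=> sr ir.
pose P (W : {set V}) := t * #|W| ^ 2 + t.+1 * #|W|.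
have Pmono W : W \subset A -> P W <= P A.
  move/subset_leq_card => l; rewrite leq_add // leq_mul2l ?l ?orbT //.
  by rewrite leq_sqr l orbT.
(* Adding [P A] keeps the maximised quantity in [nat]. *)
case: (@arg_maxnP _ A (fun W => W \subset A)
  (fun W => 5 * arcs r W W + (P A - P W)) (subxx A)) => W sWA Wmax.
exists W => //; split; last first.
  by have := Wmax A (subxx A); have := Pmono _ sWA; rewrite /P; clear; lia.
move=> x xW; set W' := W :\ x.
have sW'A : W' \subset A by rewrite (subset_trans _ sWA) // subsetDl.
have := Wmax W' sW'A.
have dW : [disjoint [set x] & W'] by rewrite disjoints1 !inE eqxx.
have eW : W = [set x] :|: W' by rewrite /W' setD1K.
have cW : #|W| = #|W'|.+1 by rewrite (cardsD1 x W) xW.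
have degW : deg_in r W x = deg_in r W' x.
  by rewrite {1}eW deg_inU // {1}/deg_in big_set1 ir.
have aW : arcs r W W = 2 * deg_in r W' x + arcs r W' W'.
  rewrite {1 2}eW arcsU // [arcs r [set x] [set x]]arcs_indep ?arcs_set1 //.
  by move=> a b /set1P -> /set1P ->; rewrite ir.
have := Pmono _ sWA; have := Pmono _ sW'A.
by rewrite /P degW aW cW -!mulnn; clear; nia.
Qed.

(** * Maximum independent sets *)

Lemma max_indep r W : symmetric r -> irreflexive r ->
  exists I, [/\ I \subset W, indep r I,
    forall J, J \subset W -> indep r J -> #|J| <= #|I|
    & forall x, x \in W -> x \notin I -> exists2 p, p \in I & r x p].
Proof.
move=> sr ir.
pose P (I : {set V}) := (I \subset W) && [forall x in I, forall y in I, ~~ r x y].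
have PP I : reflect (I \subset W /\ indep r I) (P I).
  apply: (iffP andP) => -[sI iI]; split=> //.
    by move=> x y xI yI; move/forall_inP: iI => /(_ _ xI)/forall_inP; apply.
  by apply/forall_inP=> x xI; apply/forall_inP=> y yI; apply: iI.
have P0 : P set0 by apply/PP; split; [exact: sub0set | move=> x y; rewrite inE].
case: (arg_maxnP (fun I : {set V} => #|I|) P0) => I /PP[sIW iI] Imax.
exists I; split=> // [J sJ iJ|x xW xI]; first by apply: Imax; apply/PP.
apply/exists_inP; apply: contraNT xI => /exists_inPn nx.
have /Imax : P (x |: I).
  apply/PP; split; first by rewrite subUset sub1set xW.
  move=> y z /setU1P[->|yI] /setU1P[->|zI].
  - by rewrite ir.
  - exact: nx.
  - by rewrite sr nx.
  - exact: iI.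
by rewrite /= cardsU1; case: (x \in I) => //=; clear; lia.
Qed.

Lemma trifree_deg_in r W I x : trifree r W ->
  (forall J, J \subset W -> indep r J -> #|J| <= #|I|) ->
  x \in W -> deg_in r W x <= #|I|.
Proof.
move=> tf Imax xW; rewrite deg_in_card; apply: Imax.
  by apply/subsetP=> y; rewrite inE => /andP[].
move=> y z; rewrite !inE => /andP[yW xy] /andP[zW xz].
by apply: contra (tf _ _ _ xW yW zW) => ->; rewrite xy xz.
Qed.

(** Every edge has an endpoint outside a maximum independent set [I], and
    degrees are at most [#|I|] because neighbourhoods are independent. *)
Lemma mantel r W : symmetric r -> irreflexive r -> trifree r W ->
  2 * arcs r W W <= #|W| ^ 2.
Proof.
move=> sr ir tf; have [I [sIW iI Imax _]] := max_indep W sr ir.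
have dI := disjoint_setD I W; have eW := setU_setD sIW.
have h1 : arcs r (W :\: I) W <= #|W :\: I| * #|I|.
  by apply: arcs_le => x /setDP[xW _]; apply: trifree_deg_in Imax xW.
have h2 : arcs r I W <= arcs r (W :\: I) W.
  rewrite -{1}eW arcsUr // arcs_indep // add0n arcsC //.
  by rewrite -{3}eW arcsUr // leq_addr.
have : arcs r W W = arcs r I W + arcs r (W :\: I) W by rewrite -{1}eW arcsUl.
have [/= cauchy _] := nat_Cauchy #|I| #|W :\: I|.
rewrite -(card_setD_add sIW) sqrnD; move: h1 h2 cauchy; clear; lia.
Qed.

(** Suppose [u v] is an edge outside a maximum independent set [I].  By
    maximality [u] and [v] have neighbours [q'] and [q] in [I].  A vertex is
    adjacent to at most two of [u, v, q, q'], and a vertex of [I] to at most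
    one, so the four degrees sum to at most [2 |W| - |I|]; this contradicts
    [|I| >= deg u > 2/5 |W|]. *)
Lemma dense_trifree_bipartite r W : symmetric r -> irreflexive r -> trifree r W ->
  {in W, forall x, 2 * #|W| < 5 * deg_in r W x} ->
  exists I, [/\ I \subset W, indep r I & indep r (W :\: I)].
Proof.
move=> sr ir tf dW; have [I [sIW iI Imax Inbr]] := max_indep W sr ir.
exists I; split=> // u v /setDP[uW uI] /setDP[vW vI]; apply/negP=> uv.
have [q' q'I uq'] := Inbr _ uW uI; have [q qI vq] := Inbr _ vW vI.
have qW := subsetP sIW _ qI; have q'W := subsetP sIW _ q'I.
have := trifree_deg_in tf Imax uW.
have : deg_in r W u + deg_in r W v + deg_in r W q + deg_in r W q' + #|I|
    <= 2 * #|W|.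
  rewrite (card_sum_mem sIW) (card_sum1 W) big_distrr -!big_split /=.
  apply: leq_sum => z zW.
  have := tf _ _ _ uW vW zW; rewrite uv.
  have := tf _ _ _ vW qW zW; rewrite vq.
  have := tf _ _ _ uW q'W zW; rewrite uq'.
  have : z \in I -> ~~ r q z && ~~ r q' z by move=> zI; rewrite !iI.
  case: (z \in I) => [/(_ isT)|_];
    by case: (r u z); case: (r v z); case: (r q z); case: (r q' z).
have := dW _ uW; have := dW _ vW; have := dW _ qW; have := dW _ q'W; clear; lia.
Qed.

(** * The structure of dense K_4-free graphs *)

(** The sums of degrees in this section are bounded by counting, for every
    vertex [z] of [W], how many members of a small list of vertices are adjacent
    to [z]. *)
Section Decomposition.
Variables (r : rel V) (W I : {set V}).
Hypotheses (sr : symmetric r) (kf : K4free r).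
Hypothesis dW : {in W, forall x, 3 * #|W| < 5 * deg_in r W x}.
Hypotheses (sIW : I \subset W) (iI : indep r I).
Hypothesis Imax : forall J, J \subset W -> indep r J -> #|J| <= #|I|.

Lemma edge_codegree_le x y : r x y -> \sum_(z in W) (r x z && r y z) <= #|I|.
Proof.
move=> xy; rewrite (_ : \sum_(z in W) _ = #|[set z in W | r x z && r y z]|).
  apply: Imax; first by apply/subsetP=> z; rewrite inE => /andP[].
  move=> z w; rewrite !inE => /and3P[_ xz yz] /and3P[_ xw yw].
  by apply: contra (kf x y z w) => ->; rewrite xy xz yz xw yw.
rewrite -sum1_card; under [RHS]eq_bigl do rewrite inE.
by rewrite [RHS]big_mkcondr /=; apply: eq_bigr => z _; case: (_ && _).
Qed.

(** Two vertices [q], [q'] of [I], each adjacent to two vertices of the same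
    triangle, miss the same vertex of it.  Otherwise, with [q] adjacent to
    [v, w] and [q'] to [u, w], a vertex has more than three neighbours among
    [u, v, w, q, q'] only if it lies in [N(u) :&: N(v)], and a vertex of [I]
    has at most two.  As [N(u) :&: N(v)] is no larger than [I], the five
    degrees sum to at most [3 |W|]. *)
Lemma same_missed_vertex u v w q q' : u \in W -> v \in W -> w \in W ->
  r u v -> r u w -> r v w -> q \in I -> q' \in I ->
  r q v -> r q w -> r q' u -> ~~ r q' w.
Proof.
move=> uW vW wW uv uw vw qI q'I qv qw q'u; apply/negP=> q'w.
have qW := subsetP sIW _ qI; have q'W := subsetP sIW _ q'I.
have := edge_codegree_le uv.
have : deg_in r W u + deg_in r W v + deg_in r W w + deg_in r W q
     + deg_in r W q' + #|I| <= 3 * #|W| + \sum_(z in W) (r u z && r v z).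
  rewrite (card_sum_mem sIW) (card_sum1 W) big_distrr -!big_split /=.
  apply: leq_sum => z zW.
  have := kf u v w z; rewrite uv uw vw.
  have := kf q v w z; rewrite qv qw vw.
  have := kf q' u w z; rewrite q'u q'w uw.
  have : z \in I -> ~~ r q z && ~~ r q' z by move=> zI; rewrite !iI.
  case: (z \in I) => [/(_ isT)|_];
    by case: (r u z); case: (r v z); case: (r w z); case: (r q z); case: (r q' z).
have := dW uW; have := dW vW; have := dW wW; have := dW qW; have := dW q'W.
by clear; lia.
Qed.

(** This makes [I] larger than [4/15 |W|]. *)
Lemma triangle_deg_in_le u v w : r u v -> r u w -> r v w ->
  deg_in r W u + deg_in r W v + deg_in r W w <= #|W| + 3 * #|I|.
Proof.
move=> uv uw vw.
have := edge_codegree_le uv; have := edge_codegree_le uw; have := edge_codegree_le vw.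
suff : deg_in r W u + deg_in r W v + deg_in r W w
    <= #|W| + \sum_(z in W) (r u z && r v z)
     + \sum_(z in W) (r u z && r w z) + \sum_(z in W) (r v z && r w z).
  by clear; lia.
rewrite (card_sum1 W) -!big_split /=; apply: leq_sum => z _.
by case: (r u z); case: (r v z); case: (r w z).
Qed.

(** If every vertex of [I] had at most one neighbour in the triangle, the three
    degrees, which exceed [9/5 |W|] in total, would sum to at most
    [2 |W| - |I|]; but [|I| > 4/15 |W|]. *)
Lemma two_triangle_neighbours u v w : u \in W -> v \in W -> w \in W ->
  r u v -> r u w -> r v w ->
  exists2 q, q \in I & [|| r q v && r q w, r q u && r q w | r q u && r q v].
Proof.
move=> uW vW wW uv uw vw; apply/exists_inP.
have lt := triangle_deg_in_le uv uw vw.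
apply: contraT => /exists_inPn no.
have : deg_in r W u + deg_in r W v + deg_in r W w + #|I| <= 2 * #|W|.
  rewrite (card_sum_mem sIW) (card_sum1 W) big_distrr -!big_split /=.
  apply: leq_sum => z zW.
  have := kf u v w z; rewrite uv uw vw.
  have : z \in I -> ~~ [|| r z v && r z w, r z u && r z w | r z u && r z v].
    exact: no.
  rewrite (sr z u) (sr z v) (sr z w).
  case: (z \in I) => [/(_ isT)|_];
    by case: (r u z); case: (r v z); case: (r w z).
have := dW uW; have := dW vW; have := dW wW; move: lt; clear; lia.
Qed.

(** Let [q] in [I] be adjacent to [v, w], so that [u] is the vertex of the
    triangle [u v w] missed from [I].  A neighbour [p] of [u] in [I] would give a
    triangle [u s p], missed from [I] at [p] instead of [u].  Listing
    [u, v, w, u, s, p, p, q], a vertex of [I] is adjacent to at most three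
    entries: with two neighbours in [u v w] it misses [u].  Any other vertex is
    adjacent to at most six, and to six only if it lies in [N(u) :&: N(p)],
    which is no larger than [I].  The eight degrees then sum to at most
    [5 |W| - |I|], which is too small. *)
Lemma missed_vertex_no_nbr u v w q : u \in W -> v \in W -> w \in W ->
  r u v -> r u w -> r v w -> q \in I -> r q v -> r q w ->
  {in I, forall p, ~~ r u p}.
Proof.
move=> uW vW wW uv uw vw qI qv qw p pI; apply/negP=> up.
have qW := subsetP sIW _ qI; have pW := subsetP sIW _ pI.
have miss z : z \in I -> ~~ (r u z && (r v z || r w z)).
  move=> zI; apply/negP=> /andP[]; rewrite sr => zu /orP[] zz.
    have := @same_missed_vertex u w v q z uW wW vW uw uv.
    by rewrite (sr w v) (sr z v) zz => /(_ vw qI zI qw qv zu).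
  have := same_missed_vertex uW vW wW uv uw vw qI zI qv qw zu.
  by rewrite sr zz.
have [|s sW /andP[us ps]] := @common_neighbour r W u p.
  by have := dW uW; have := dW pW; clear; lia.
have := edge_codegree_le up; have := triangle_deg_in_le uv uw vw.
have : deg_in r W u + deg_in r W v + deg_in r W w + deg_in r W u + deg_in r W s
     + 2 * deg_in r W p + deg_in r W q + 2 * #|I|
    <= 5 * #|W| + \sum_(z in W) (r u z && r p z).
  rewrite (card_sum_mem sIW) (card_sum1 W) !big_distrr -!big_split /=.
  apply: leq_sum => z zW.
  have := kf u v w z; rewrite uv uw vw.
  have := kf q v w z; rewrite qv qw vw.
  have := kf u s p z; rewrite us up (sr s p) ps.
  have : z \in I -> [&& ~~ r q z, ~~ r p z & ~~ (r u z && (r v z || r w z))].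
    by move=> zI; rewrite !iI // miss.
  case: (z \in I) => [/(_ isT)|_]; by case: (r u z); case: (r v z);
    case: (r w z); case: (r q z); case: (r p z); case: (r s z).
have := dW uW; have := dW vW; have := dW wW; have := dW qW; have := dW pW.
by have := dW sW; clear; lia.
Qed.

End Decomposition.

(** A triangle outside a maximum independent set [I] would have a vertex missed
    from [I], hence without neighbours in [I], against the maximality of [I]. *)
Lemma dense_K4free_split r W : symmetric r -> irreflexive r -> K4free r ->
  {in W, forall x, 3 * #|W| < 5 * deg_in r W x} ->
  exists I, [/\ I \subset W, indep r I & trifree r (W :\: I)].
Proof.
move=> sr ir kf dW; have [I [sIW iI Imax Inbr]] := max_indep W sr ir.
exists I; split=> // u v w /setDP[uW uI] /setDP[vW vI] /setDP[wW wI].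
apply/negP=> /and3P[uv uw vw].
have no_nbr := missed_vertex_no_nbr sr kf dW sIW iI Imax.
have vu : r v u by rewrite sr.
have wu : r w u by rewrite sr.
have wv : r w v by rewrite sr.
have [q qI] := two_triangle_neighbours sr kf dW sIW Imax uW vW wW uv uw vw.
case/or3P=> /andP[q1 q2].
- have [p pI up] := Inbr _ uW uI.
  by have := no_nbr _ _ _ _ uW vW wW uv uw vw qI q1 q2 p pI; rewrite up.
- have [p pI vp] := Inbr _ vW vI.
  by have := no_nbr _ _ _ _ vW uW wW vu vw uw qI q1 q2 p pI; rewrite vp.
- have [p pI wp] := Inbr _ wW wI.
  by have := no_nbr _ _ _ _ wW uW vW wu wv uv qI q1 q2 p pI; rewrite wp.
Qed.

(** * Bipartite subgraphs against triangle-free subgraphs *)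

(** The numerical part of [trifree_bicolour], with [s], [m], [k] the sizes of
    the whole set, of its dense core and of the rest, and [hX], [gX] the
    numbers of arcs on [X].  The assumptions [hS1] to [hW1] force [m] to be
    at least [9/20] of [s], and then cutting half of the new arcs of [g]
    makes up for the arcs of [h] lost by the deletions. *)
Lemma bicolour_arith s m k Y hS hW gS gW cut :
  k + m = s -> 200 * Y <= 29 * s -> 200 <= s ->
  gS < 2 * hS -> s * (s - Y) <= gS ->
  5 * hS + 2 * m ^ 2 + 3 * m <= 5 * hW + 2 * s ^ 2 + 3 * s ->
  2 * hW <= m ^ 2 ->
  2 * k * (s - Y) + gW <= gS + k ^ 2 ->
  2 * hW + gS <= 2 * cut + gW -> hS <= cut.
Proof.
move=> ks Ys s0 hS1.
move: (leq_subr Y s); set D := s - Y => Ds gS1 core hW1 gain ext.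
have YD : Y + D = s by rewrite /D subnKC //; move: Ys; clear; lia.
have m1 : 9 * s + 120 <= 20 * m.
  rewrite leqNgt; apply/negP => lt.
  have h1 : (20 * m) ^ 2 <= (9 * s + 120) ^ 2 by rewrite leq_sqr ltnW.
  have h2 : s * (171 * s) <= s * (200 * D).
    by rewrite leq_mul2l; apply/orP; right; move: Ys YD; clear; lia.
  have h3 : 200 * s <= s ^ 2 by rewrite -mulnn leq_mul2r s0 orbT.
  move: h1 h2 h3 hS1 gS1 core hW1 s0.
  by rewrite !(expnMn, sqrnD) -!mulnn; clear; lia.
have h1 : k * (8 * s + k + 6) <= k * (10 * D).
  by rewrite leq_mul2l; apply/orP; right; move: m1 ks YD Ys; clear; lia.
by move: h1 core gain ext; rewrite -ks -!mulnn; clear; lia.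
Qed.

(** [Y] bounds the number of vertices of [S] not adjacent in [g] to a given
    vertex of [S]; the argument works as long as [Y / |S| < 3/20], and [29/200]
    leaves room for the lower order terms. *)
Lemma trifree_bicolour g h S Y : symmetric g -> irreflexive g ->
  symmetric h -> irreflexive h -> (forall x y, h x y -> g x y) ->
  trifree h S -> {in S, forall x, #|S| <= deg_in g S x + Y} ->
  200 * Y <= 29 * #|S| -> 200 <= #|S| ->
  exists f : V -> 'I_2, arcs h S S <= arcs (cut_rel g f) S S.
Proof.
move=> sg ig sh ih hg tf gY YS S0.
have [le|lt] := leqP (2 * arcs h S S) (arcs g S S).
  have [f Hf] := extend_colouring (fun=> ord0 : 'I_2) sg ig (sub0set S).
  by exists f; move: Hf le; rewrite !arcs0; clear; lia.
have [W sWS [dW core]] := dense_core 2 S sh ih.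
have tfW : trifree h W by move=> x y z xW yW zW; apply: tf; apply: (subsetP sWS).
have [I [sIW iI iJ]] := dense_trifree_bipartite sh ih tfW dW.
pose f0 x : 'I_2 := if x \in I then ord0 else ord_max.
have [f Hf] := extend_colouring f0 sg ig sWS.
exists f.
have hW : arcs h W W <= arcs (cut_rel g f0) W W.
  apply: arcs_mono => x y xW yW xy; rewrite /cut_rel hg //= /f0.
  case: ifP => xI; case: ifP => yI //.
    by move: (iI _ _ xI yI); rewrite xy.
  by move: (iJ x y); rewrite !inE xI yI xW yW xy => /(_ isT isT).
have gY' : {in S, forall x, #|S| - Y <= deg_in g S x}.
  by move=> x /gY; clear; lia.
have gain := arcs_outside_ge sg sWS gY'.
have gS : #|S| * (#|S| - Y) <= arcs g S S by apply: arcs_ge.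
have hWW := mantel sh ih tfW.
apply: (bicolour_arith (card_setD_add sWS) YS S0 lt gS core hWW gain).
by move: Hf hW; clear; lia.
Qed.

(** * 3-partite subgraphs against K_4-free subgraphs *)

(** Here [i] and [s] are the sizes of the independent and of the triangle-free
    part of the dense core.  In [10 i s - 3 (i + s)^2] the worst ratio is
    [3 i = 2 s]; for that ratio the assumptions become
    [5/6 s^2 >= (0.1383 - o(1)) n^2]. *)
Lemma trifree_part_large n i s Y hV hW :
  2000 <= n -> 2000 * Y <= 117 * n ->
  1883 * n ^ 2 < 3000 * hV ->
  5 * hV + 3 * (i + s) ^ 2 + 4 * (i + s) <= 5 * hW + 3 * n ^ 2 + 4 * n ->
  2 * hW <= s ^ 2 + 4 * (i * s) ->
  200 * Y <= 29 * s /\ 2 * n <= 5 * s.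
Proof.
move=> n0 Yn hV1 core hW1.
have h2 : 24 * (i * s) <= 18 * i ^ 2 + 8 * s ^ 2.
  have [/= h _] := nat_Cauchy (3 * i) (2 * s).
  by move: h; rewrite !expnMn; clear; lia.
have n1 : 2000 * n <= n ^ 2 by rewrite -mulnn leq_mul2r n0 orbT.
have h3 : 30 * hV <= 5 * s ^ 2 + 18 * n ^ 2 + 24 * n.
  by move: core hW1 h2; rewrite sqrnD; clear; lia.
have key : 117 * n <= 290 * s.
  rewrite leqNgt; apply/negP => lt.
  have : (290 * s) ^ 2 <= (117 * n) ^ 2 by rewrite leq_sqr ltnW.
  by move: h3 hV1 n1; rewrite -!mulnn; clear; lia.
by move: key Yn n0; clear; lia.
Qed.

Lemma tricolour_arith n k m Y hV hW gV gW cut :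
  2000 <= n -> k + m = n -> 5 * k <= 3 * n -> 2000 * Y <= 117 * n ->
  5 * hV + 3 * m ^ 2 + 4 * m <= 5 * hW + 3 * n ^ 2 + 4 * n ->
  2 * k * (n - Y) + gW <= gV + k ^ 2 ->
  3 * hW + 2 * gV <= 3 * cut + 2 * gW -> hV <= cut.
Proof.
move=> n0 kn kn3 Yn; set D := n - Y => core gain ext.
have YD : Y + D = n by rewrite /D subnKC //; move: Yn n0; clear; lia.
have h1 : k * (18 * n + k + 12) <= k * (20 * D).
  by rewrite leq_mul2l; apply/orP; right; move: kn3 n0 YD Yn; clear; lia.
by move: h1 core gain ext; rewrite -kn -!mulnn; clear; lia.
Qed.

Lemma K4free_tricolour g h : symmetric g -> irreflexive g ->
  symmetric h -> irreflexive h -> (forall x y, h x y -> g x y) ->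
  K4free h -> 2000 <= #|V| -> (forall x, 1883 * #|V| <= 2000 * deg_in g setT x) ->
  exists f : V -> 'I_3, arcs h setT setT <= arcs (cut_rel g f) setT setT.
Proof.
move=> sg ig sh ih hg kf n0 gn.
have [le|lt] := leqP (3 * arcs h setT setT) (2 * arcs g setT setT).
  have [f Hf] := extend_colouring (fun=> ord0 : 'I_3) sg ig (sub0set setT).
  by exists f; move: Hf le; rewrite !arcs0; clear; lia.
have [W _ [dW core]] := dense_core 3 setT sh ih.
have [I [sIW iI tfS]] := dense_K4free_split sh ih kf dW.
have dIS := disjoint_setD I W; have eW := setU_setD sIW.
have cW := card_setD_add sIW; rewrite addnC in cW.
set S := W :\: I in tfS dIS eW cW.
have hW : arcs h W W = 2 * arcs h I S + arcs h S S.
  by rewrite -eW arcsU // arcs_indep.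
have hS := mantel sh ih tfS.
have hIS : arcs h I S <= #|I| * #|S| by apply: arcs_le => x _; apply: deg_in_le.
have gg : #|V| * (1883 * #|V|) <= 2000 * arcs g setT setT.
  rewrite -{1}cardsT -sum_nat_const /arcs big_distrr /=.
  by apply: leq_sum => x _; apply: gn.
have hV : 1883 * #|V| ^ 2 < 3000 * arcs h setT setT.
  by move: gg lt n0; rewrite -mulnn; clear; lia.
pose Y := 117 * #|V| %/ 2000.
have YV : 2000 * Y <= 117 * #|V| by rewrite mulnC leq_divM.
have hW' : 2 * arcs h W W <= #|S| ^ 2 + 4 * (#|I| * #|S|).
  by move: hW hS hIS; clear; lia.
move: core; rewrite cardsT -cW => core.
have [YS Sn] := trifree_part_large n0 YV hV core hW'.
have gY x : #|V| <= deg_in g setT x + Y.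
  have := gn x; have : 117 * #|V| < 2000 * Y.+1.
    by rewrite [2000 * _]mulnC; apply: ltn_ceil.
  by move: n0; clear; lia.
have gS : {in S, forall x, #|S| <= deg_in g S x + Y}.
  move=> x xS; have := gY x; have -> : [set: V] = S :|: ~: S by rewrite setUCr.
  rewrite deg_inU; last by rewrite -setI_eq0 setICr.
  by have := deg_in_le g (~: S) x; have := cardsC S; clear; lia.
have S0 : 200 <= #|S| by move: Sn n0; clear; lia.
have [f2 Hf2] := trifree_bicolour sg ig sh ih hg tfS gS YS S0.
pose f0 x : 'I_3 := if x \in I then ord_max else widen_ord (leqnSn 2) (f2 x).
have [f Hf] := extend_colouring f0 sg ig (subsetT W).
exists f.
have SI x : x \in S -> (x \in I) = false by rewrite inE => /andP[/negPf].
have wI x : (ord_max == widen_ord (leqnSn 2) (f2 x)) = false.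
  rewrite -val_eqE /=; have := ltn_ord (f2 x); clear.
  by case: eqP => // <-; rewrite ltnn.
have cut0 : arcs h W W <= arcs (cut_rel g f0) W W.
  have sc : symmetric (cut_rel g f0) by move=> x y; rewrite /cut_rel sg eq_sym.
  rewrite hW -[in X in _ <= X]eW arcsU //.
  have : arcs h I S <= arcs (cut_rel g f0) I S.
    apply: arcs_mono => x y xI yS xy; rewrite /cut_rel hg //= /f0 xI SI //.
    by rewrite wI.
  have : arcs (cut_rel g f2) S S <= arcs (cut_rel g f0) S S.
    by apply: arcs_mono => x y xS yS /andP[xy ne]; rewrite /cut_rel xy /= /f0 !SI.
  by move: Hf2; clear; lia.
have gV : {in [set: V], forall x, #|V| - Y <= deg_in g setT x}.
  by move=> x _; have := gY x; clear; lia.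
have gain := arcs_outside_ge sg (subsetT W) gV.
have cV : #|[set: V] :\: W| + (#|I| + #|S|) = #|V|.
  by rewrite cW card_setD_add ?subsetT // cardsT.
have k3 : 5 * #|[set: V] :\: W| <= 3 * #|V| by move: cV Sn; clear; lia.
apply: (tricolour_arith n0 cV k3 YV core gain).
by move: cut0 Hf; clear; lia.
Qed.

End Counting.

(** * Edge sets *)

Section Graphs.
Variable V : finType.
Implicit Types (G H : {set {set V}}).

Lemma adj_sym G : symmetric (adj G).
Proof. by move=> x y; rewrite /adj setUC. Qed.

Lemma adj_irrefl G : simple_graph G -> irreflexive (adj G).
Proof.
move=> /forall_inP sG x; apply/negbTE/negP => /sG.
by rewrite setUid cards1.
Qed.

Lemma simple_graph_sub G H : H \subset G -> simple_graph G -> simple_graph H.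
Proof.
by move=> /subsetP sHG /forall_inP sG; apply/forall_inP => e /sHG /sG.
Qed.

Lemma arcs_adj G : simple_graph G -> arcs (adj G) setT setT = 2 * #|G|.
Proof.
move=> sG; have cG e : e \in G -> #|e| = 2.
  by move/forall_inP: sG => /(_ e) h /h /eqP.
have deg x : deg_in (adj G) setT x = \sum_(e in G) (x \in e).
  rewrite deg_in_card (_ : [set y in [set: V] | adj G x y] = [set y | adj G x y]);
    last by apply/setP => y; rewrite !inE.
  transitivity #|[set e in G | x \in e]|; last first.
    rewrite -sum1_card; under eq_bigl do rewrite inE.
    by rewrite big_mkcondr; apply: eq_bigr => e _; case: (x \in e).
  rewrite -(card_in_imset (f := fun y => [set x; y])) => [|y z]; last first.
    rewrite !inE => xy xz e; have : y \in [set x; z] by rewrite -e set22.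
    case/set2P => // yx; move: xy; rewrite yx => /cG.
    by rewrite setUid cards1.
  apply: eq_card => e; rewrite inE; apply/imsetP/andP => [[y]|[eG xe]].
    by rewrite inE => xy ->; rewrite set21.
  have /eqP/cards2P[a [b [ab ee]]] := cG e eG.
  move: xe; rewrite ee => /set2P[->|->].
    by exists b; rewrite // inE /adj -ee.
  by exists a; rewrite ?inE /adj setUC -?ee.
rewrite /arcs (eq_bigr _ (fun x _ => deg x)) exchange_big /=.
rewrite (eq_bigr (fun=> 2)) => [|e eG]; first by rewrite sum_nat_const mulnC.
rewrite -(cG e eG) -sum1_card [RHS]big_mkcond /= big_mkcond /=.
by apply: eq_bigr => x _; rewrite inE; case: (x \in e).
Qed.

Definition cut_edges k G (f : V -> 'I_k) : {set {set V}} :=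
  [set e in G | [exists x in e, exists y in e, f x != f y]].

Lemma adj_cut_edges k G (f : V -> 'I_k) : adj (cut_edges G f) =2 cut_rel (adj G) f.
Proof.
move=> x y; rewrite /cut_rel /adj inE; congr (_ && _).
apply/exists_inP/idP => [[a /set2P[]->]|ne].
- by case/exists_inP => b /set2P[]->; rewrite ?eqxx.
- by case/exists_inP => b /set2P[]->; rewrite ?eqxx // eq_sym.
- by exists x; rewrite ?set21 //; apply/exists_inP; exists y; rewrite ?set22.
Qed.

Lemma arcs_cut_le_P3 G (f : V -> 'I_3) : simple_graph G ->
  arcs (cut_rel (adj G) f) setT setT <= 2 * P3 G.
Proof.
move=> sG; have sH : cut_edges G f \subset G.
  by apply/subsetP => e; rewrite inE => /andP[].
have -> : arcs (cut_rel (adj G) f) setT setT = arcs (adj (cut_edges G f)) setT setT.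
  by apply: eq_bigr => x _; apply: eq_bigr => y _; rewrite adj_cut_edges.
rewrite arcs_adj ?(simple_graph_sub sH) // leq_mul2l /=.
apply: (leq_bigmax_cond (F := fun H => #|H|)); rewrite sH /=; apply/existsP.
exists (finfun f); apply/forallP => x; apply/forallP => y.
by rewrite adj_cut_edges !ffunE; apply/implyP => /andP[].
Qed.

Lemma clique_free_K4free H : simple_graph H -> clique_free 4 H -> K4free (adj H).
Proof.
move=> sH cf x y z w; apply: contra cf => /and5P[xy xz xw yz /andP[yw zw]].
have ne a b : adj H a b -> a != b.
  by apply: contraTneq => ->; rewrite adj_irrefl.
apply/existsP; exists [set x; y; z; w]; apply/andP; split.
  by rewrite -!setUA !cardsU1 cards1 !inE !negb_or !ne.
apply/forall_inP => a; rewrite !inE -!orbA => aK; apply/forall_inP => b.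
rewrite !inE -!orbA => bK; apply/implyP.
by case/or4P: aK => /eqP->; case/or4P: bK => /eqP->; rewrite ?eqxx // adj_sym.
Qed.

(** A colouring of a 3-partite graph is injective on cliques. *)
Lemma P3_le_K4f G : P3 G <= K4f G.
Proof.
apply/bigmax_leqP => H /andP[sHG /existsP[f /forallP fH]].
apply: (leq_bigmax_cond (F := fun H => #|H|)); rewrite sHG /=.
apply/existsP => -[K /andP[/eqP cK /forall_inP clK]].
have inj : {in K &, injective f}.
  move=> x y xK yK fxy; apply/eqP; apply: contraTT (xK) => ne.
  have /forall_inP/(_ y yK)/implyP/(_ ne) xy := clK x xK.
  by have /forallP/(_ y)/implyP/(_ xy) := fH x; rewrite fxy eqxx.
have := subset_leq_card (subsetT (f @: K)).
by rewrite (card_in_imset inj) cK cardsT card_ord.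
Qed.

Lemma min_degree_le G x : min_degree G <= degree G x.
Proof.
rewrite /min_degree; have : x \in index_enum V by rewrite mem_index_enum.
elim: (index_enum V) => [|y s IH]; rewrite ?in_nil // in_cons big_cons geq_min.
by case/orP => [/eqP->|/IH ->]; rewrite ?leqnn ?orbT.
Qed.

(** [1883 / 2000 = 0.9415]. *)
Theorem dense_P3_eq_K4f G : simple_graph G -> 2000 <= #|V| ->
  1883 * #|V| <= 2000 * min_degree G -> P3 G = K4f G.
Proof.
move=> sG n0 dG; apply/eqP; rewrite eqn_leq P3_le_K4f /=.
apply/bigmax_leqP => H /andP[sHG cf]; have sH := simple_graph_sub sHG sG.
have hg x y : adj H x y -> adj G x y by move/(subsetP sHG).
have gn x : 1883 * #|V| <= 2000 * deg_in (adj G) setT x.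
  rewrite (leq_trans dG) // leq_mul2l (leq_trans (min_degree_le G x)) ?orbT //.
  rewrite deg_in_card /degree leq_eqVlt; apply/orP; left; apply/eqP.
  by apply: eq_card => y; rewrite !inE.
have [f] := K4free_tricolour (adj_sym G) (adj_irrefl sG) (adj_sym H)
  (adj_irrefl sH) hg (clique_free_K4free sH cf) n0 gn.
rewrite arcs_adj // => lef.
by have := leq_trans lef (arcs_cut_le_P3 f sG); rewrite leq_mul2l.
Qed.

End Graphs.

(** * The threshold *)

From mathcomp Require Import all_classical all_reals all_analysis.
Import GRing.Theory Num.Theory.
Local Open Scope ring_scope.
Local Open Scope ereal_scope.

Theorem theorem1p2 (R : realType) : delta4 R <= (9415%:R / 10000%:R)%:E.
Proof.
apply: ereal_inf_lbound; exists (9415%:R / 10000%:R)%R; last by [].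
exists 2000%N => // n n0 V G cV sG dG.
apply: dense_P3_eq_K4f => //; rewrite cV; first exact: n0.
(* Numerals this large are opaque to [lra]. *)
have e1 : 9415%N = (5 * 1883)%N by [].
have e2 : 10000%N = (5 * 2000)%N by [].
rewrite -(@ler_nat R) !natrM; move: dG; rewrite e1 e2 !natrM; lra.
Qed.
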